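(* Let $G$ be a finite group, let $p$ be a prime dividing $|G|$, and let $m \geq 1$ be an integer. Suppose that $g, h \in G$, $h$ commutes with $g$, and $h$ has order a power of $p$. Then for all unramified characters $\chi$ of $G$ (at $p$), $$\chi(g) \equiv \chi(g h^{p^{m-1}}) \mod p^m.$$
   Context: For a complex character $\chi$ of $G$, $\mathbb{Q}(\chi)$ is the field generated over $\mathbb{Q}$ by the values of $\chi$; $\chi$ is unramified (at $p$) if the field extension $\mathbb{Q}(\chi)/\mathbb{Q}$ is unramified at $p$. For algebraic integers $a,b$, $a \equiv b \mod p^m$ means that $(a-b)/p^m$ is an algebraic integer. *)

(* Defs.v *)
From HB Require Import structures.
From mathcomp Require Import all_boot all_order all_algebra.
From mathcomp Require Import all_fingroup all_solvable all_field all_character.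

Set Implicit Arguments.
Unset Strict Implicit.
Unset Printing Implicit Defensive.

Import Order.TTheory GRing.Theory Num.Theory.
Local Open Scope ring_scope.

(* Subfields, rings of integers and ideals are Prop-valued subsets of algC, so
   that no decidability is imposed on them. *)
Definition same_set (A B : algC -> Prop) : Prop := forall x, A x <-> B x.

(* As x / 0 = 0 in algC, the clause for y = 0 only requires S 0. *)
Definition subfield (S : algC -> Prop) : Prop :=
  [/\ S 1,
      forall x y, S x -> S y -> S (x - y)
    & forall x y, S x -> S y -> S (x / y)].

(* Q is the prime field of algC, so it lies in every subfield and need not be
   adjoined explicitly. *)
Definition character_field (gT : finGroupType) (G : {group gT}) (chi : 'CF(G))
    (x : algC) : Prop :=
  forall S : algC -> Prop,
    subfield S -> (forall g, g \in G -> S (chi g)) -> S x.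

Definition ring_of_integers (K : algC -> Prop) (x : algC) : Prop :=
  K x /\ x \in Aint.

Section Ideals.

Variable O : algC -> Prop.

Definition is_ideal (I : algC -> Prop) : Prop :=
  [/\ forall x, I x -> O x,
      I 0,
      forall x y, I x -> I y -> I (x + y)
    & forall a x, O a -> I x -> I (a * x)].

Definition prime_ideal (P : algC -> Prop) : Prop :=
  [/\ is_ideal P,
      ~ P 1
    & forall a b, O a -> O b -> P (a * b) -> P a \/ P b].

Definition principal_ideal (a x : algC) : Prop := exists2 y, O y & x = a * y.

Definition ideal_mul (I J : algC -> Prop) (x : algC) : Prop :=
  exists2 s : seq (algC * algC),
    forall ab, ab \in s -> I ab.1 /\ J ab.2
  & x = \sum_(ab <- s) ab.1 * ab.2.

Definition ideal_exp (I : algC -> Prop) (n : nat) : algC -> Prop :=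
  iter n (ideal_mul I) O.

Definition prime_factorization (I : algC -> Prop) (r : nat)
    (P : 'I_r -> algC -> Prop) (e : 'I_r -> nat) : Prop :=
  [/\ forall i, prime_ideal (P i),
      forall i j, i != j -> ~ same_set (P i) (P j),
      forall i, (0 < e i)%N
    & same_set I (\big[ideal_mul/O]_(i < r) ideal_exp (P i) (e i))].

End Ideals.

(* In pO_K = P_1^e_1 ... P_r^e_r all the ramification indices e_i are 1.  The
   residue extensions are extensions of finite fields, hence always separable.
   By unique factorization it is immaterial whether one asks this of some or
   of every factorization; asking for existence is never vacuous. *)
Definition unramified_at (p : nat) (K : algC -> Prop) : Prop :=
  let O := ring_of_integers K in
  exists (r : nat) (P : 'I_r -> algC -> Prop) (e : 'I_r -> nat),
    prime_factorization O (principal_ideal O p%:R) P e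
    /\ forall i, e i = 1%N.

(* Main.v *)
Require Import Defs.
From mathcomp Require Import all_boot all_order all_algebra.
From mathcomp Require Import all_fingroup all_solvable all_field all_character.
From mathcomp Require Import ring.
From Stdlib Require Import Classical.

(** Let n = |G| = p^(a+1) m with p not dividing m, and let K be the field of
    values of chi.  Unramifiedness is used through one consequence: the ring of
    integers O of K is reduced modulo p, that is, an element of O with a power
    in p O lies in p O ([unramified_reduced]).  Indeed p O is a product of
    distinct primes, distinct primes over p are comaximal, so the product is
    their intersection.

    The unramified field K is fixed by the inertia group at p.  Modulo the
    ideal [nilmod p] of the algebraic integers that are nilpotent modulo p, every
    n-th root of unity equals an m-th root of unity.  Hence both x |-> x^q, for q = p^f
    congruent to 1 mod m, and an automorphism u with u z = z^k on n-th roots of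
    unity, for k congruent to 1 mod m, are the identity modulo [nilmod p] on the
    span Z[zeta_n] of these roots.  This passes to O because Z[zeta_n] is
    saturated at p ([cycint_saturated]), so that every element of O has a multiple
    prime to p in Z[zeta_n].  As O is reduced modulo p, each x in O
    then satisfies u x = x mod p and x = y^p mod p O for some y in O.  The latter
    lifts u = 1 mod p^s to u = 1 mod p^(s+1), and so u = 1 on O
    ([inertia_fixes_unramified]).

    The restriction psi of chi to A = <g, h> is therefore invariant under
    lambda |-> lambda^k, for k congruent to 1 mod p m.  The orbit of a linear
    character lambda has p^c elements, where p^c is the order of lambda^(p m),
    and the sum of their values at x is p^c lambda(x) or 0 according to whether
    lambda(x)^(p m) is 1 or not.  Between x = g and x = g h^(p^r), where the
    congruence is to hold modulo p^(r+1), the orbit sums differ by p^r times an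
    element of [nilmod p]: for c = r this comes from eps - 1 being nilpotent
    modulo p when eps^p = 1 ([conj_irr_sum_diff]).  So
    (chi g - chi (g h^(p^r))) / p^r is an element of K in [nilmod p], and
    reducedness provides the last factor p. *)

Set Implicit Arguments.
Unset Strict Implicit.
Unset Printing Implicit Defensive.

Import Order.TTheory GRing.Theory Num.Theory.

(** * Subrings of algebraic numbers and congruences modulo p *)

Section Subrings.
Local Open Scope ring_scope.

(** Closure as a predicate in Prop, so that it applies to the ring of integers
    of a subfield given as in [subfield]; congruence of x and y modulo p in S
    is then expressed as S ((x - y) / p). *)
Definition subring (S : algC -> Prop) : Prop :=
  [/\ S 1, forall x y, S x -> S y -> S (x - y)
    & forall x y, S x -> S y -> S (x * y)].

Lemma subring_Aint : subring (fun x => x \in Aint).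
Proof. by split=> [|x y|x y]; [exact: rpred1 | exact: rpredB | exact: rpredM]. Qed.

Lemma subfield_subring (K : algC -> Prop) : subfield K -> subring K.
Proof.
case=> K1 KB KV; split=> // x y Kx Ky.
have -> : x * y = x / (1 / y) by rewrite div1r invrK.
by apply: (KV) => //; exact: KV.
Qed.

Section Closure.
Variables (S : algC -> Prop) (ringS : subring S).

Lemma subring1 : S 1. Proof. by case: ringS. Qed.
Lemma subringB x y : S x -> S y -> S (x - y).
Proof. by case: ringS => _ h _; exact: h. Qed.
Lemma subringM x y : S x -> S y -> S (x * y). Proof. by case: ringS => _ _; apply. Qed.
Lemma subring0 : S 0. Proof. by rewrite -(subrr 1); apply: subringB; exact: subring1. Qed.
Lemma subringN x : S x -> S (- x). Proof. by rewrite -sub0r; apply/subringB/subring0. Qed.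
Lemma subringD x y : S x -> S y -> S (x + y).
Proof. by move=> Sx Sy; rewrite -[y]opprK; apply: subringB Sx (subringN Sy). Qed.
Lemma subringX x n : S x -> S (x ^+ n).
Proof.
by move=> Sx; elim: n => [|n IHn]; [exact: subring1 | rewrite exprS; exact: subringM].
Qed.
Lemma subring_sum I (r : seq I) (P : pred I) F :
  (forall i, P i -> S (F i)) -> S (\sum_(i <- r | P i) F i).
Proof. by move=> SF; elim/big_rec: _ => [|i x /SF]; [exact: subring0 | exact: subringD]. Qed.
Lemma subring_nat n : S n%:R.
Proof.
by elim: n => [|n IHn]; rewrite ?mulrS; [exact: subring0 | exact: subringD subring1 IHn].
Qed.
Lemma subring_int (z : int) : S z%:~R.
Proof.
by case: z => n; rewrite ?NegzE ?mulrNz -pmulrn; try apply: subringN; exact: subring_nat.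
Qed.

Section Frobenius.
Variables (p : nat) (p_pr : prime p).

Let p_neq0 : p%:R != 0 :> algC.
Proof. by rewrite pnatr_eq0 -lt0n prime_gt0. Qed.

Lemma eqmodX x y n :
  S x -> S y -> S ((x - y) / p%:R) -> S ((x ^+ n - y ^+ n) / p%:R).
Proof.
move=> Sx Sy Sxy; rewrite subrXX mulrAC; apply: subringM => //.
by apply: subring_sum => i _; apply: subringM; exact: subringX.
Qed.

Lemma frobenius1D x y :
  S x -> S y -> S (((x + y) ^+ p - (x ^+ p + y ^+ p)) / p%:R).
Proof.
move=> Sx Sy; have p_gt0 := prime_gt0 p_pr.
rewrite exprDn; case: p p_pr p_neq0 p_gt0 => // n n_pr n_neq0 _.
rewrite big_ord_recr big_ord_recl /= subn0 subnn !expr0 mulr1 mul1r bin0 binn.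
rewrite !mulr1n [X in X - _](_ : _ = x ^+ n.+1 + y ^+ n.+1 + \sum_(i < n)
   x ^+ (n.+1 - bump 0 i) * y ^+ bump 0 i *+ 'C(n.+1, bump 0 i)); last by ring.
rewrite addrC addKr mulr_suml; apply: subring_sum => i _.
have /dvdnP[c ->]: (n.+1 %| 'C(n.+1, bump 0 i))%N.
  by apply: prime_dvd_bin; rewrite // /bump ltnS ltn_ord.
rewrite mulrnA -[X in X / _]mulr_natr mulfK // -mulr_natr.
by apply: subringM (subring_nat _); apply: subringM; exact: subringX.
Qed.

Lemma frobeniusD k x y :
  S x -> S y ->
  S (((x + y) ^+ (p ^ k) - (x ^+ (p ^ k) + y ^+ (p ^ k))) / p%:R).
Proof.
move=> Sx Sy; elim: k => [|k IHk].
  by rewrite expn0 !expr1 subrr mul0r; exact: subring0.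
rewrite expnSr !exprM; set u := _ ^+ _ in IHk *.
set v := x ^+ _ in IHk *; set w := y ^+ _ in IHk *.
have Sv : S v by exact: subringX.
have Sw : S w by exact: subringX.
rewrite -(subrKA ((v + w) ^+ p)) mulrDl; apply: subringD (frobenius1D _ _) => //.
by apply: eqmodX IHk; [apply/subringX/subringD | exact: subringD].
Qed.

Lemma frobeniusB k x y :
  S x -> S y ->
  S (((x - y) ^+ (p ^ k) - (x ^+ (p ^ k) - y ^+ (p ^ k))) / p%:R).
Proof.
move=> Sx Sy; have Sxy := subringB Sx Sy.
have := subringN (frobeniusD k Sxy Sy); rewrite subrK -mulNr.
by congr (S (_ / _)); ring.
Qed.

(** Lifting the exponent: x^p - y^p is (x - y) times a sum of p terms that are
    all congruent to y^(p - 1) modulo p. *)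
Lemma eqmod_lift s x y : S x -> S y ->
  S ((x - y) / p%:R ^+ s.+1) -> S ((x ^+ p - y ^+ p) / p%:R ^+ s.+2).
Proof.
move=> Sx Sy Sxy; rewrite subrXX exprSr invfM.
set t := \sum_(i < p) _; rewrite mulrACA; apply: subringM => //.
have S1 : S ((x - y) / p%:R).
  have := subringM Sxy (subring_nat (p ^ s)); rewrite natrX exprS.
  by rewrite invfM mulrA mulfVK // expf_neq0.
rewrite -(subrK (y ^+ p.-1 *+ p) t) mulrDl -[y ^+ _ *+ _]mulr_natr mulfK //.
apply: subringD (subringX _ Sy); rewrite mulr_natr.
have -> : y ^+ p.-1 *+ p = \sum_(i < p) y ^+ p.-1 by rewrite sumr_const card_ord.
rewrite -sumrB mulr_suml.
apply: subring_sum => i _.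
have -> : y ^+ p.-1 = y ^+ (p.-1 - i) * y ^+ i.
  by rewrite -exprD subnK // -ltnS prednK ?prime_gt0.
by rewrite -mulrBl mulrAC; apply: subringM (subringX _ Sy); exact: eqmodX.
Qed.

(** Multiplying an integral equation for x / p by the power of p one below its
    degree clears the denominators except in the leading term.  This transfers
    divisibility by p in all algebraic integers to the smaller ring S. *)
Lemma expr_divp x : S x -> x / p%:R \in Aint -> exists k, S (x ^+ k.+1 / p%:R).
Proof.
move=> Sx At; set t := x / _ in At.
have := root_minCpoly t; have := minCpoly_monic t; have := size_minCpoly t.
have [q ->] := floorpP At; set P := map_poly _ q.
case szP: (size P) => [|[|k]] // _ mP /rootP Pt; exists k.
move: Pt; rewrite horner_coef szP big_ord_recr /=.
have -> : P`_k.+1 = 1 by move/monicP: mP; rewrite /lead_coef szP.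
rewrite mul1r => /(canRL (addKr _)); rewrite addr0 => tk.
have p0 n : p%:R ^+ n != 0 :> algC by rewrite expf_neq0.
have -> : x ^+ k.+1 / p%:R = p%:R ^+ k * t ^+ k.+1.
  by rewrite expr_div_n [p%:R ^+ k.+1]exprSr invfM mulrCA mulVKf.
rewrite tk mulrN; apply: subringN; rewrite mulr_sumr; apply: subring_sum => i _.
have -> : p%:R ^+ k * (P`_i * t ^+ i) = P`_i * p%:R ^+ (k - i) * x ^+ i.
  have -> : p%:R ^+ k = p%:R ^+ (k - i) * p%:R ^+ i :> algC.
    by rewrite -exprD subnK // -ltnS.
  rewrite expr_div_n mulrACA [_ * P`_i]mulrC.
  by rewrite (mulrCA (p%:R ^+ i)) divff // mulr1.
rewrite coef_map; apply: subringM (subringX _ Sx).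
by apply: subringM (subring_int _) (subringX _ (subring_nat _)).
Qed.

End Frobenius.

(** N is, up to sign, the lowest nonzero coefficient of an integer polynomial
    vanishing at b, since that coefficient is b times a polynomial in b. *)
Lemma dvd_nat_of_Aint b : S b -> b \in Aint -> b != 0 ->
  exists2 w, S w & exists2 N, (0 < N)%N & b * w = N%:R.
Proof.
move=> Sb Ab b0; have := root_minCpoly b; have := minCpoly_eq0 b.
have [q ->] := floorpP Ab; elim/poly_ind: q => [|q c IHq].
  by rewrite rmorph0 eqxx.
rewrite rmorphD rmorphM /= map_polyX map_polyC /= => nz.
rewrite rootE !hornerE => e.
have Sq: S (map_poly intr q).[b].
  rewrite horner_coef; apply: subring_sum => i _; rewrite coef_map.
  exact: subringM (subring_int _) (subringX _ Sb).
have [c0 | c0] := eqVneq c 0.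
  move: nz e; rewrite c0 /= addr0 mulf_eq0 polyX_eq0 orbF addr0 => nz.
  by rewrite mulf_eq0 (negPf b0) orbF; apply: IHq.
have {}e : b * - (map_poly intr q).[b] = c%:~R.
  by rewrite mulrN mulrC; apply/eqP; rewrite eq_sym -addr_eq0 addrC.
case: c c0 e {nz} => n n0 e.
  by exists (- (map_poly intr q).[b]); [exact: subringN | exists n; rewrite ?lt0n].
exists (map_poly intr q).[b] => //; exists n.+1 => //.
by move: e; rewrite NegzE mulrN mulrNz => /oppr_inj.
Qed.

End Closure.
End Subrings.

(** * The nilradical of the algebraic integers modulo p *)

Section Radical.
Local Open Scope ring_scope.
Variables (p : nat) (p_pr : prime p).

(** The exponent is a power of p so that closure under sums follows directly
    from the additivity of Frobenius; any positive exponent gives the same set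
    ([nilmod_of_exp]). *)
Definition nilmod (x : algC) : Prop :=
  x \in Aint /\ exists k, x ^+ (p ^ k) / p%:R \in Aint.

Let p_neq0 : p%:R != 0 :> algC.
Proof. by rewrite pnatr_eq0 -lt0n prime_gt0. Qed.

Lemma nilmod_Aint x : nilmod x -> x \in Aint. Proof. by case. Qed.

Lemma nilmodMl a x : a \in Aint -> nilmod x -> nilmod (a * x).
Proof.
move=> Aa [Ax [k Axk]]; split; first exact: rpredM.
by exists k; rewrite exprMn -mulrA rpredM ?rpredX.
Qed.

Lemma nilmodMr a x : a \in Aint -> nilmod x -> nilmod (x * a).
Proof. by rewrite mulrC; exact: nilmodMl. Qed.

Lemma nilmod_divp x : x / p%:R \in Aint -> nilmod x.
Proof.
move=> Ax; rewrite -(divfK p_neq0 x); apply: nilmodMl => //.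
split; first exact: rpred_nat.
by exists 0%N; rewrite divff ?rpred1.
Qed.

Lemma nilmod_exp_le x k N : x \in Aint -> (k <= N)%N ->
  x ^+ k / p%:R \in Aint -> x ^+ N / p%:R \in Aint.
Proof.
by move=> Ax kN Axk; rewrite -(subnK kN) exprD -mulrA rpredM ?rpredX.
Qed.

Lemma nilmodD x y : nilmod x -> nilmod y -> nilmod (x + y).
Proof.
move=> [Ax [k Axk]] [Ay [l Ayl]]; split; first exact: rpredD.
exists (maxn k l).
rewrite -(subrK (x ^+ (p ^ maxn k l) + y ^+ (p ^ maxn k l)) ((x + y) ^+ _)).
rewrite mulrDl; apply: rpredD.
  by apply: (frobeniusD subring_Aint).
rewrite mulrDl; apply: rpredD.
  by apply: nilmod_exp_le Axk; rewrite // leq_pexp2l ?prime_gt0 ?leq_maxl.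
by apply: nilmod_exp_le Ayl; rewrite // leq_pexp2l ?prime_gt0 ?leq_maxr.
Qed.

Lemma nilmodB x y : nilmod x -> nilmod y -> nilmod (x - y).
Proof. by move=> rx ry; rewrite -mulN1r; apply/nilmodD/nilmodMl; rewrite ?rpredN1. Qed.

Lemma nilmod0 : nilmod 0.
Proof. by apply: nilmod_divp; rewrite mul0r rpred0. Qed.

Lemma nilmod_sum I (r : seq I) (P : pred I) F :
  (forall i, P i -> nilmod (F i)) -> nilmod (\sum_(i <- r | P i) F i).
Proof. by move=> rF; elim/big_rec: _ => [|i x /rF]; [exact: nilmod0 | exact: nilmodD]. Qed.

Lemma nilmod_of_exp x N : x \in Aint -> nilmod (x ^+ N.+1) -> nilmod x.
Proof.
move=> Ax [_ [k Axk]]; split=> //; exists (N.+1 + k)%N.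
move: Axk; rewrite -exprM; apply: nilmod_exp_le => //.
by rewrite expnD leq_pmul2r ?expn_gt0 ?prime_gt0 // ltnW // ltn_expl ?prime_gt1.
Qed.

(** A Bezout relation writes x as a multiple of D x plus a multiple of p. *)
Lemma nilmod_of_coprime D x : coprime D p -> x \in Aint -> nilmod (D%:R * x) -> nilmod x.
Proof.
move=> coDp Ax rDx; have D0 : (0 < D)%N.
  case: D coDp {rDx} => //; rewrite /coprime gcd0n => /eqP p1.
  by have := prime_gt1 p_pr; rewrite p1.
case: (egcdnP p D0) => k l; rewrite (eqP coDp) => kD _.
have -> : x = k%:R * (D%:R * x) - p%:R * (l%:R * x).
  by rewrite !mulrA -!natrM kD natrD [(p * l)%N]mulnC; ring.
apply: nilmodB; first by apply: nilmodMl => //; exact: rpred_nat.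
by apply: nilmod_divp; rewrite mulrC mulKf // rpredM ?rpred_nat.
Qed.

Lemma nilmod_unity_root a e : e ^+ (p ^ a) = 1 -> nilmod (e - 1).
Proof.
move=> e1; have Ae : e \in Aint.
  by apply: (@Aint_unity_root (p ^ a)); rewrite ?expn_gt0 ?prime_gt0 //; apply/unity_rootP.
split; first by rewrite rpredB ?rpred1.
exists a; have := frobeniusB subring_Aint p_pr a Ae (rpred1 _).
by rewrite e1 expr1n subrr subr0.
Qed.

End Radical.

(** * Cyclotomic integers and their saturation at p *)

Section CyclotomicIntegers.
Local Open Scope ring_scope.

(** Z[zeta_d] as the additive span of the d-th roots of unity: a property of
    Frobenius or of a field automorphism is then proved by induction from its
    validity on roots of unity. *)
Inductive cycint (d : nat) : algC -> Prop :=
| Cycint0 : cycint d 0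
| CycintD z x of z ^+ d = 1 & cycint d x : cycint d (x + z)
| CycintB z x of z ^+ d = 1 & cycint d x : cycint d (x - z).

Lemma cycint_root d z : z ^+ d = 1 -> cycint d z.
Proof. by move=> z1; rewrite -[z]add0r; apply: CycintD => //; exact: Cycint0. Qed.

Lemma subring_cycint d : subring (cycint d).
Proof.
have subC x y : cycint d x -> cycint d y -> cycint d (x - y).
  move=> cx; elim=> [|z {}y z1 _ IH|z {}y z1 _ IH]; first by rewrite subr0.
    by rewrite opprD addrA; exact: CycintB.
  by rewrite opprB addrCA addrC; exact: CycintD.
split=> // [|x y cx]; first by apply: cycint_root; exact: expr1n.
have mulC z : z ^+ d = 1 -> cycint d (x * z).
  move=> z1; elim: cx => [|w {}x w1 _ IH|w {}x w1 _ IH].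
  - by rewrite mul0r; exact: Cycint0.
  - by rewrite mulrDl; apply: CycintD; rewrite // exprMn w1 z1 mulr1.
  by rewrite mulrBl; apply: CycintB; rewrite // exprMn w1 z1 mulr1.
elim=> [|z {}y z1 _ IH|z {}y z1 _ IH].
- by rewrite mulr0; exact: Cycint0.
- rewrite mulrDr -[x * z]opprK; apply: (subC) => //; rewrite -sub0r.
  by apply: subC (Cycint0 d) _; exact: mulC.
by rewrite mulrBr; apply: subC => //; exact: mulC.
Qed.

Lemma cycint_Aint d x : (0 < d)%N -> cycint d x -> x \in Aint.
Proof.
move=> d0; have Ar z : z ^+ d = 1 -> z \in Aint.
  by move=> z1; apply: (Aint_unity_root d0); apply/unity_rootP.
elim=> [|z {}x /Ar Az _ Ax|z {}x /Ar Az _ Ax]; first exact: rpred0.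
  exact: rpredD.
exact: rpredB.
Qed.

Lemma cycint_dvd d n x : (d %| n)%N -> cycint d x -> cycint n x.
Proof.
move=> /dvdnP[k ->]; have r z : z ^+ d = 1 -> z ^+ (k * d) = 1.
  by move=> z1; rewrite mulnC exprM z1 expr1n.
elim=> [|z {}x /r z1 _ IH|z {}x /r z1 _ IH]; first exact: Cycint0.
  exact: CycintD.
exact: CycintB.
Qed.

End CyclotomicIntegers.

Section Saturation.
Local Open Scope ring_scope.
Variables (p : nat) (p_pr : prime p).

Let p_gt0 := prime_gt0 p_pr.
Let p_neq0 : p%:R != 0 :> algC.
Proof. by rewrite pnatr_eq0 -lt0n. Qed.

Lemma cycint_frobenius m f x : (p ^ f = 1 %[mod m])%N -> cycint m x ->
  cycint m ((x ^+ (p ^ f) - x) / p%:R).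
Proof.
move=> qm; have ringC := subring_cycint m.
have frob z : z ^+ m = 1 -> z ^+ (p ^ f) = z.
  by move=> z1; rewrite -(expr_mod _ z1) qm expr_mod // expr1.
elim=> [|z {}x z1 cx IH|z {}x z1 cx IH].
- by rewrite expr0n eqn0Ngt expn_gt0 p_gt0 /= subrr mul0r; exact: Cycint0.
- have := frobeniusD ringC p_pr f cx (cycint_root z1).
  rewrite (frob _ _ z1) => /(subringD ringC IH).
  by rewrite -mulrDl; congr (cycint _ (_ / _)); ring.
have := frobeniusB ringC p_pr f cx (cycint_root z1).
rewrite (frob _ _ z1) => /(subringD ringC IH).
by rewrite -mulrDl; congr (cycint _ (_ / _)); ring.
Qed.

(** Z[zeta_m] is reduced modulo p when p does not divide m, because iterating
    Frobenius totient(m) times is the identity modulo p: x is congruent to each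
    x^(p^f) with f a multiple of totient(m), and one of these is divisible by p. *)
Lemma cycint_nilmod m x : coprime p m -> (0 < m)%N ->
  cycint m x -> nilmod p x -> cycint m (x / p%:R).
Proof.
move=> copm m0 cx [Ax [k Axk]]; have ringC := subring_cycint m.
have [l cxl] := expr_divp ringC p_pr (subringX ringC (p ^ k) cx) Axk.
pose E := (p ^ k * l.+1)%N; rewrite -exprM -/E in cxl.
pose f := (totient m * E)%N.
have qm : (p ^ f = 1 %[mod m])%N.
  by rewrite expnM -modnXm Euler_exp_totient // modnXm exp1n.
have Ef : (E <= p ^ f)%N.
  rewrite (leq_trans (ltnW (ltn_expl E (prime_gt1 p_pr)))) //.
  by rewrite leq_pexp2l // leq_pmull // totient_gt0.
have := cycint_frobenius qm cx; rewrite mulrBl => c1.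
rewrite -[x / _](subKr (x ^+ (p ^ f) / p%:R)); apply: (subringB ringC) => //.
by rewrite -(subnK Ef) exprD -mulrA; apply: (subringM ringC) => //; exact: subringX.
Qed.

Section PrimePower.
Variables (a m : nat) (w : algC).
Hypotheses (copm : coprime p m) (m_gt0 : (0 < m)%N).
Hypothesis w_prim : (p ^ a.+1).-primitive_root w.

Local Notation n := (p ^ a.+1 * m)%N.
Let n_gt0 : (0 < n)%N. Proof. by rewrite muln_gt0 expn_gt0 p_gt0. Qed.
Let ringC := subring_cycint n.
Let w_n : w ^+ n = 1.
Proof. by rewrite exprM (prim_expr_order w_prim) expr1n. Qed.

(** The value at 1 of the cyclotomic polynomial of order p^(a+1), obtained as
    the quotient of X^(p^(a+1)) - 1 by X^(p^a) - 1. *)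
Lemma prod_one_sub_prim_root :
  \prod_(k < p ^ a.+1 | ~~ (p %| k)%N) (1 - w ^+ k) = p%:R.
Proof.
pose Q : {poly algC} := \prod_(k < p ^ a.+1 | ~~ (p %| k)%N) ('X - (w ^+ k)%:P).
pose M := (p ^ a)%N; have pM : (p ^ a.+1 = M * p)%N by rewrite expnSr.
have M0 : (0 < M)%N by rewrite expn_gt0 p_gt0.
have XM0 : 'X^M - 1 != 0 :> {poly algC}.
  by rewrite -size_poly_gt0 -polyC1 size_XnsubC.
have prM : M.-primitive_root (w ^+ p).
  by have := exp_prim_root w_prim p; rewrite pM gcdnMl mulnK.
have eQ : Q * ('X^M - 1) = (\sum_(i < p) 'X^(M * i)) * ('X^M - 1).
  transitivity ('X^(p ^ a.+1) - 1 : {poly algC}).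
    rewrite -(factor_Xn_sub_1 w_prim) -(factor_Xn_sub_1 prM) !big_mkord.
    rewrite [RHS](bigID (fun k : 'I_ _ => ~~ (p %| k)%N)) /=; congr (_ * _).
    have ltpM (j : 'I_M) : (p * j < p ^ a.+1)%N.
      by rewrite pM mulnC ltn_pmul2r.
    have ltdM (k : 'I_(p ^ a.+1)) : (k %/ p < M)%N by rewrite ltn_divLR // -pM.
    rewrite (reindex_onto (fun j => Ordinal (ltpM j)) (fun k => Ordinal (ltdM k))) /=.
      apply: eq_big => [j | j _]; last by rewrite exprM.
      by rewrite dvdn_mulr //= -val_eqE /= mulKn // eqxx.
    by move=> k; rewrite negbK => pk; apply: val_inj; rewrite /= mulnC divnK.
  rewrite pM exprM subrX1 mulrC; congr (_ * _).
  by apply: eq_bigr => i _; rewrite exprM.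
have := congr1 (fun P : {poly algC} => P.[1]) (mulIf XM0 eQ).
rewrite horner_prod horner_sum.
under eq_bigr do rewrite hornerXsubC.
under [X in _ = X]eq_bigr do rewrite hornerXn expr1n.
by rewrite sumr_const card_ord.
Qed.

Local Notation pi := (1 - w).

Let one_sub_neq0 (k : nat) : ~~ (p %| k)%N -> 1 - w ^+ k != 0.
Proof.
apply: contraNneq => /eqP; rewrite subr_eq0 eq_sym -(prim_order_dvd w_prim).
by apply: dvdn_trans; rewrite dvdn_exp.
Qed.

Let pi_neq0 : pi != 0.
Proof.
by rewrite -[w]expr1 one_sub_neq0 // dvdn1 gtn_eqF ?prime_gt1.
Qed.

(* As 1 - w ^+ k is pi times a unit for k prime to p, p and pi ^+ e are
   associates. *)
Let e := #|[pred k : 'I_(p ^ a.+1) | ~~ (p %| k)%N]|.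

Let one_sub_quo k : cycint n ((1 - w ^+ k) / pi).
Proof.
rewrite -opprB subrX1 -mulNr opprB mulrAC divff // mul1r.
by apply: (subring_sum ringC) => i _; apply/(subringX ringC)/cycint_root.
Qed.

Let one_sub_quoV (k : nat) : ~~ (p %| k)%N -> cycint n (pi / (1 - w ^+ k)).
Proof.
move=> pk; have k_neq0 := one_sub_neq0 pk.
have cokN : coprime k (p ^ a.+1) by rewrite coprime_sym coprimeXl // prime_coprime.
have k_gt0 : (0 < k)%N by case: (k) pk; rewrite ?dvdn0.
case: (egcdnP (p ^ a.+1) k_gt0) => u v; rewrite (eqP cokN) => uv _.
have wk : w = (w ^+ k) ^+ u.
  by rewrite -exprM mulnC uv exprD mulnC exprM (prim_expr_order w_prim) expr1n mul1r.
rewrite {1}wk -opprB subrX1 -mulNr opprB mulrAC divff // mul1r.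
by apply: (subring_sum ringC) => i _; do 2! apply: (subringX ringC); exact: cycint_root.
Qed.

Let sub_prod I (r : seq I) (P : pred I) F :
  (forall i, P i -> cycint n (F i)) -> cycint n (\prod_(i <- r | P i) F i).
Proof.
move=> SF; elim/big_rec: _ => [|i x /SF]; [exact: (subring1 ringC) | exact: (subringM ringC)].
Qed.

Let p_over_pi : cycint n (p%:R / pi ^+ e).
Proof.
rewrite -prod_one_sub_prim_root -prodr_const -prodf_div.
by apply: sub_prod.
Qed.

Let pi_over_p : cycint n (pi ^+ e / p%:R).
Proof.
rewrite -prod_one_sub_prim_root -prodr_const -prodf_div.
by apply: sub_prod => k; exact: one_sub_quoV.
Qed.

Let nilmod_pi : nilmod p pi.
Proof.
rewrite -opprB -mulN1r; apply: nilmodMl; first by rewrite rpredN1.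
by apply: (nilmod_unity_root p_pr (a := a.+1)); exact: prim_expr_order.
Qed.

(** An n-th root of unity is the product of an m-th root of unity and a power
    of w, and powers of w are congruent to 1 modulo pi. *)
Lemma cycint_split x : cycint n x ->
  exists2 c, cycint m c & exists2 z, cycint n z & x = c + pi * z.
Proof.
have split_root z : z ^+ n = 1 ->
    exists2 c, c ^+ m = 1 & exists2 y, cycint n y & z = c + pi * y.
  move=> z1; have coNm : coprime (p ^ a.+1) m by rewrite coprimeXl.
  pose i := chinese (p ^ a.+1) m 0 1; pose j := chinese (p ^ a.+1) m 1 0.
  have ij1 : z = z ^+ i * z ^+ j.
    rewrite -exprD -(expr_mod _ z1) -[LHS]expr1 -(expr_mod 1 z1); congr (_ ^+ _).
    apply/eqP; rewrite chinese_remainder //.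
    by rewrite -!(modnDm i j) !chinese_modl // !chinese_modr // !modnDm !eqxx.
  have im : (z ^+ i) ^+ m = 1.
    rewrite -exprM -(expr_mod _ z1); suff -> : (i * m %% n = 0)%N by [].
    apply/eqP; rewrite -/(dvdn _ _) dvdn_pmul2r //.
    by rewrite /dvdn chinese_modl // mod0n.
  have [k zj] : {k : 'I_(p ^ a.+1) | z ^+ j = w ^+ k}.
    apply: (prim_rootP w_prim); rewrite -exprM -(expr_mod _ z1).
    suff -> : (j * p ^ a.+1 %% n = 0)%N by [].
    apply/eqP; rewrite -/(dvdn _ _) mulnC dvdn_pmul2r ?expn_gt0 ?p_gt0 //.
    by rewrite /dvdn chinese_modr // mod0n.
  exists (z ^+ i) => //; exists (- (z ^+ i * ((1 - w ^+ k) / pi))).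
    apply/(subringN ringC)/(subringM ringC) => //; apply: cycint_root.
    by rewrite -exprM mulnC exprM z1 expr1n.
  by rewrite {1}ij1 zj mulrN mulrCA [pi * _]mulrC divfK //; ring.
elim=> [|z {}x /split_root[c1 c1m [y1 Cy1 ->]] _ [c Cc [y Cy ->]]|
        z {}x /split_root[c1 c1m [y1 Cy1 ->]] _ [c Cc [y Cy ->]]].
- exists 0; first exact: Cycint0.
  by exists 0; [exact: Cycint0 | rewrite mulr0 addr0].
- exists (c + c1); first exact: CycintD.
  by exists (y + y1); [exact: (subringD ringC) | ring].
exists (c - c1); first exact: CycintB.
by exists (y - y1); [exact: (subringB ringC) | ring].
Qed.

(** Expand y in powers of pi with coefficients in Z[zeta_m].  As long as the
    exponent j is less than e, a leading coefficient c is divisible by pi, hence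
    nilpotent modulo p, hence divisible by p by [cycint_nilmod], and the term
    c pi^j can be discarded; and pi^e is itself divisible by p. *)
Lemma cycint_saturated y : cycint n y -> y / p%:R \in Aint -> cycint n (y / p%:R).
Proof.
move=> Cy Ay; have AC := cycint_Aint n_gt0.
have [z Cz] : exists2 z, cycint n z & cycint n ((y - pi ^+ e * z) / p%:R).
  elim: {-2}e (leqnn e) => [|j IHj] je.
    by exists y; rewrite // mul1r subrr mul0r; exact: Cycint0.
  have [z Cz Cyz] := IHj (ltnW je).
  have Az : z / pi \in Aint.
    have Ajz : pi ^+ j * z / p%:R \in Aint.
      have -> : pi ^+ j * z / p%:R = y / p%:R - (y - pi ^+ j * z) / p%:R by ring.
      by apply: rpredB Ay _; exact: AC.
    have -> : z / pi = pi ^+ j * z / p%:R * (p%:R / pi ^+ e * pi ^+ (e - j.+1)).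
      have pij i : pi ^+ i != 0 by exact: expf_neq0.
      have -> : pi ^+ e = pi ^+ (e - j.+1) * (pi * pi ^+ j).
        by rewrite -exprS -exprD subnK.
      move: (pij j) (pij (e - j.+1)%N); move: (pi ^+ j) (pi ^+ (e - _)) => u v u0 v0.
      by field; rewrite p_neq0 pi_neq0 u0 v0.
    rewrite rpredM // rpredM ?rpredX ?(nilmod_Aint nilmod_pi) //; exact: AC.
  have rz : nilmod p z by rewrite -[z](divfK pi_neq0); exact: nilmodMl.
  have [c Cc [z1 Cz1 zE]] := cycint_split Cz.
  have rc : nilmod p c.
    rewrite -[c](addrK (pi * z1)) -zE; apply: (nilmodB p_pr) => //.
    by apply: nilmodMr => //; exact: AC.
  exists z1 => //; have := cycint_dvd (dvdn_mull _ (dvdnn m)) (cycint_nilmod copm m_gt0 Cc rc).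
  move=> /(_ (p ^ a.+1)%N) Ccp.
  have -> : (y - pi ^+ j.+1 * z1) / p%:R =
      (y - pi ^+ j * z) / p%:R + pi ^+ j * (c / p%:R).
    by rewrite zE exprS; ring.
  apply: (subringD ringC Cyz); apply: (subringM ringC) => //.
  apply: (subringX ringC); apply: (subringB ringC (subring1 ringC)); exact: cycint_root.
move=> Cyz; have -> : y / p%:R = (y - pi ^+ e * z) / p%:R + pi ^+ e / p%:R * z.
  by ring.
by apply: (subringD ringC Cyz); exact: (subringM ringC).
Qed.

(** The powers of p in a denominator are removed one at a time by saturation. *)
Lemma cycint_primeto D x : (0 < D)%N -> x \in Aint -> cycint n (D%:R * x) ->
  exists2 D', coprime D' p & cycint n (D'%:R * x).
Proof.
move=> D0 Ax; have [D' copD ->] := pfactor_coprime p_pr D0.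
elim: (logn p D) => [|k IHk].
  by rewrite muln1; exists D'; rewrite // coprime_sym.
move=> C; apply: IHk; have := cycint_saturated C.
have -> : (D' * p ^ k.+1)%:R * x / p%:R = (D' * p ^ k)%:R * x.
  by rewrite expnSr mulnA natrM mulrAC mulfK.
by apply; rewrite rpredM ?rpred_nat.
Qed.

End PrimePower.
End Saturation.

(** * Frobenius and inertia on cyclotomic integers *)

Section RootsModRadical.
Local Open Scope ring_scope.
Variables (p : nat) (p_pr : prime p) (a m : nat).

Let p_gt0 := prime_gt0 p_pr.
Local Notation n := (p ^ a * m)%N.
Hypothesis m_gt0 : (0 < m)%N.
Let n_gt0 : (0 < n)%N. Proof. by rewrite muln_gt0 expn_gt0 p_gt0. Qed.
Let ringC := subring_cycint n.

(** The quotient z^(i - 1) of z^i by z has order dividing p^a. *)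
Lemma nilmod_root_exp (z : algC) i : (0 < i)%N -> (i = 1 %[mod m])%N -> z ^+ n = 1 ->
  nilmod p (z ^+ i - z).
Proof.
move=> i0 i1 z1; have -> : z ^+ i - z = z * (z ^+ i.-1 - 1).
  by rewrite mulrBr mulr1 -exprS prednK.
apply: nilmodMl; first by apply: (@Aint_unity_root n) => //; apply/unity_rootP.
apply: (nilmod_unity_root p_pr (a := a)).
have /dvdnP[t ->] : (m %| i.-1)%N by rewrite -subn1 -eqn_mod_dvd // i1.
by rewrite -exprM -mulnA [(m * _)%N]mulnC mulnC exprM z1 expr1n.
Qed.

Lemma cycint_frobenius_nilmod f (x : algC) : (p ^ f = 1 %[mod m])%N -> cycint n x ->
  nilmod p (x ^+ (p ^ f) - x).
Proof.
move=> qm; have q0 : (0 < p ^ f)%N by rewrite expn_gt0 p_gt0.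
have AC := cycint_Aint n_gt0.
elim=> [|z {}x z1 Cx IH|z {}x z1 Cx IH].
- by rewrite expr0n eqn0Ngt q0 subrr; exact: nilmod0.
- rewrite [X in nilmod _ X](_ : _ = ((x + z) ^+ (p ^ f) - (x ^+ (p ^ f) + z ^+ (p ^ f)))
     + ((x ^+ (p ^ f) - x) + (z ^+ (p ^ f) - z))); last by ring.
  apply: (nilmodD p_pr); last by apply: (nilmodD p_pr) => //; exact: nilmod_root_exp.
  apply: (nilmod_divp p_pr); apply: (frobeniusD subring_Aint p_pr); apply: AC => //.
  exact: cycint_root.
rewrite [X in nilmod _ X](_ : _ = ((x - z) ^+ (p ^ f) - (x ^+ (p ^ f) - z ^+ (p ^ f)))
   + ((x ^+ (p ^ f) - x) - (z ^+ (p ^ f) - z))); last by ring.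
apply: (nilmodD p_pr); last by apply: (nilmodB p_pr) => //; exact: nilmod_root_exp.
apply: (nilmod_divp p_pr); apply: (frobeniusB subring_Aint p_pr); apply: AC => //.
exact: cycint_root.
Qed.

Lemma cycint_aut_nilmod (u : {rmorphism algC -> algC}) k x :
  (0 < k)%N -> (k = 1 %[mod m])%N -> (forall z, z ^+ n = 1 -> u z = z ^+ k) ->
  cycint n x -> nilmod p (u x - x).
Proof.
move=> k0 k1 uE; elim=> [|z {}x z1 Cx IH|z {}x z1 Cx IH].
- by rewrite rmorph0 subrr; exact: nilmod0.
- rewrite rmorphD (uE z) // opprD addrACA.
  by apply: (nilmodD p_pr) => //; exact: nilmod_root_exp.
rewrite rmorphB (uE z) // opprB addrACA -opprB opprK [in X in _ + X]addrC.
rewrite [X in nilmod _ X](_ : _ = (u x - x) - (z ^+ k - z)); last by ring.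
by apply: (nilmodB p_pr) => //; exact: nilmod_root_exp.
Qed.

End RootsModRadical.

(** * Cyclotomic fields and character values *)

Section CyclotomicField.
Local Open Scope ring_scope.

(** The cyclotomic field Q(zeta_d), as the fractions with positive integer
    denominators. *)
Definition cycrat (d : nat) (x : algC) : Prop :=
  exists2 D, (0 < D)%N & cycint d (D%:R * x).

Lemma subfield_cycrat d : (0 < d)%N -> subfield (cycrat d).
Proof.
move=> d0; have ringC := subring_cycint d.
have nz D : (0 < D)%N -> D%:R != 0 :> algC by rewrite pnatr_eq0 lt0n.
split=> [|x y [D D0 Dx] [E E0 Ey]|x y [D D0 Dx] [E E0 Ey]].
- by exists 1%N; rewrite // mul1r; exact: (subring1 ringC).
- exists (D * E)%N; first by rewrite muln_gt0 D0.
  have -> : (D * E)%:R * (x - y) = E%:R * (D%:R * x) - D%:R * (E%:R * y).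
    by rewrite natrM; ring.
  by apply: (subringB ringC); apply: (subringM ringC) => //; exact: (subring_nat ringC).
have [->|y0] := eqVneq y 0.
  by exists 1%N; rewrite // invr0 mulr0 mulr0; exact: (subring0 ringC).
have b0 : E%:R * y != 0 by rewrite mulf_neq0 ?nz.
have [w Cw [N N0 bw]] := dvd_nat_of_Aint ringC Ey (cycint_Aint d0 Ey) b0.
exists (D * N)%N; first by rewrite muln_gt0 D0.
have -> : (D * N)%:R * (x / y) = D%:R * x * (E%:R * w).
  by rewrite natrM -bw; field.
by do 2!apply: (subringM ringC) => //; exact: (subring_nat ringC).
Qed.

Lemma char_cycint (gT : finGroupType) (G : {group gT}) (chi : 'CF(G)) g :
  chi \is a character -> cycint #|G| (chi g).
Proof.
move=> Nchi; have ringC := subring_cycint #|G|.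
have [gG | /cfun0->] := boolP (g \in G); last exact: Cycint0.
have sgG : (<[g]> \subset G)%g by rewrite cycle_subG.
have [r Er] := char_sum_irr (cfRes_char <[g]>%G Nchi).
rewrite -(cfResE chi sgG (cycle_id g)) Er sum_cfunE.
apply: (subring_sum ringC) => i _; apply: cycint_root.
have lin : 'chi_i \is a linear_char by apply/char_abelianP; exact: cycle_abelian.
have /dvdnP[k ->] : (#[g]%g %| #|G|)%N by exact: order_dvdG.
by rewrite mulnC exprM (lin_char_unity_root lin (cycle_id g)) expr1n.
Qed.

End CyclotomicField.

(** * Reducedness modulo p and triviality of inertia in unramified fields *)

Section Unramified.
Local Open Scope ring_scope.
Variables (p : nat) (p_pr : prime p) (K : algC -> Prop).
Hypotheses (fieldK : subfield K) (unrK : unramified_at p K).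
Variable f : nat.
Hypothesis frobK : forall x, K x -> x \in Aint -> nilmod p (x ^+ (p ^ f.+1) - x).

Let p_gt0 := prime_gt0 p_pr.
Let p_neq0 : p%:R != 0 :> algC.
Proof. by rewrite pnatr_eq0 -lt0n. Qed.

Let divK x y : K x -> K y -> K (x / y).
Proof. by case: fieldK => _ _; apply. Qed.

Let ringK := subfield_subring fieldK.

Local Notation O := (ring_of_integers K).

Let ringO : subring O.
Proof.
split=> [|x y [Kx Ax] [Ky Ay]|x y [Kx Ax] [Ky Ay]].
- by split; [exact: (subring1 ringK) | exact: rpred1].
- by split; [exact: (subringB ringK) | exact: rpredB].
by split; [exact: (subringM ringK) | exact: rpredM].
Qed.

Section Ideal.
Variables (I J : algC -> Prop) (idI : is_ideal O I) (idJ : is_ideal O J).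

Lemma ideal_mul_l x : ideal_mul I J x -> I x.
Proof.
case=> s sIJ ->; have [_ I0 ID IM] := idI; have [JO _ _ _] := idJ.
elim: s sIJ => [|ab s IHs] sIJ; rewrite ?big_nil ?big_cons //.
apply: ID; last by apply: IHs => cd scd; apply: sIJ; rewrite inE scd orbT.
by have [Ia Jb] := sIJ ab (mem_head _ _); rewrite mulrC; apply/IM/Ia/JO.
Qed.

Lemma ideal_mul_r x : ideal_mul I J x -> J x.
Proof.
case=> s sIJ ->; have [IO _ _ _] := idI; have [_ J0 JD JM] := idJ.
elim: s sIJ => [|ab s IHs] sIJ; rewrite ?big_nil ?big_cons //.
apply: JD; last by apply: IHs => cd scd; apply: sIJ; rewrite inE scd orbT.
by have [Ia Jb] := sIJ ab (mem_head _ _); apply/JM/Jb/IO.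
Qed.

Lemma ideal_mulM a b : I a -> J b -> ideal_mul I J (a * b).
Proof.
by move=> Ia Jb; exists [:: (a, b)]; rewrite ?big_seq1 // => ab /[1!inE]/eqP->.
Qed.

Lemma ideal_mulD x y : ideal_mul I J x -> ideal_mul I J y -> ideal_mul I J (x + y).
Proof.
move=> [s sIJ ->] [t tIJ ->]; exists (s ++ t); last by rewrite big_cat.
by move=> ab; rewrite mem_cat => /orP[/sIJ|/tIJ].
Qed.

Lemma ideal_mul_ideal : is_ideal O (ideal_mul I J).
Proof.
have [IO I0 ID IM] := idI; split.
- by move=> x /ideal_mul_l/IO.
- by exists [::]; rewrite ?big_nil.
- exact: ideal_mulD.
move=> a x Oa [s sIJ ->]; exists [seq (a * bc.1, bc.2) | bc <- s].
  by move=> _ /mapP[bc /sIJ[Ib Jc] ->]; split=> //; exact: IM.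
by rewrite big_map mulr_sumr; apply: eq_bigr => bc _; rewrite mulrA.
Qed.

End Ideal.

Lemma unit_ideal : is_ideal O O.
Proof.
split=> //; first exact: (subring0 ringO).
  by move=> x y; exact: (subringD ringO).
by move=> x y; exact: (subringM ringO).
Qed.

Lemma nilmod_prime_ideal P x : prime_ideal O P -> P p%:R -> O x -> nilmod p x -> P x.
Proof.
move=> [[PO P0 PD PM] P1 PP] Pp Ox [_ [k Axk]].
have {Axk}: P (x ^+ (p ^ k)).
  rewrite -(divfK p_neq0 (x ^+ _)); apply: PM => //; split=> //.
  apply: divK; last exact: (subring_nat ringK).
  by apply: (subringX ringK); case: Ox.
elim: (p ^ k)%N => [/P1//|i IHi]; rewrite exprS => /PP[] //.
exact: (subringX ringO).
Qed.

(** The residue ring is a domain on which x |-> x^q is the identity, with q > 1,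
    so it is a field. *)
Lemma prime_ideal_inv P x : prime_ideal O P -> P p%:R -> O x -> ~ P x ->
  exists2 c, O c & P (1 - x * c).
Proof.
move=> prP Pp Ox nPx; have [[PO P0 PD PM] P1 PP] := prP.
have q1 : (1 < p ^ f.+1)%N by rewrite (ltn_exp2l 0) ?prime_gt1.
have e : x ^+ (p ^ f.+1) - x = x * (x ^+ (p ^ f.+1).-1 - 1).
  by rewrite mulrBr mulr1 -exprS prednK // ltnW.
have Oy : O (x ^+ (p ^ f.+1).-1 - 1).
  by apply: (subringB ringO (subringX ringO _ Ox)); exact: (subring1 ringO).
have: P (x * (x ^+ (p ^ f.+1).-1 - 1)).
  apply: nilmod_prime_ideal => //; first exact: (subringM ringO).
  by rewrite -e; case: Ox; exact: frobK.
case/(PP _ _ Ox Oy) => // Py.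
exists (x ^+ (p ^ f.+1).-2); first exact: (subringX ringO).
rewrite -exprS prednK; last by rewrite -subn1 subn_gt0.
rewrite -opprB -mulN1r; apply: PM => //.
by apply: (subringN ringO); exact: (subring1 ringO).
Qed.

(** Primes over p are maximal by [prime_ideal_inv], so any element of one
    outside the other produces the required b.  Which of the two is not contained
    in the other is unknown, hence the two cases. *)
Lemma prime_ideals_comaximal P P' :
  prime_ideal O P -> P p%:R -> prime_ideal O P' -> P' p%:R ->
  ~ same_set P P' -> exists2 b, P' b & P (1 - b).
Proof.
move=> prP Pp prP' Pp' neq.
have [[PO _ _ PM] _ _] := prP; have [[PO' _ _ PM'] _ _] := prP'.
have [[x [Px' nPx]]|sub] := classic (exists x, P' x /\ ~ P x).
  have Ox := PO' _ Px'; have [c Oc Pc] := prime_ideal_inv prP Pp Ox nPx.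
  by exists (x * c) => //; rewrite mulrC; exact: PM'.
have [[x [Px nPx']]|sub'] := classic (exists x, P x /\ ~ P' x).
  have Ox := PO _ Px; have [c Oc Pc] := prime_ideal_inv prP' Pp' Ox nPx'.
  by exists (1 - x * c) => //; rewrite subKr mulrC; exact: PM.
by case: neq => x; split=> [Px|Px']; apply: NNPP => nP; [apply: sub'|apply: sub]; exists x.
Qed.

(** The family Q is a copy of P up to equality of sets: it stands for the powers
    of the P i with exponent 1, which are ideal products P i * O and not
    syntactically P i. *)
Section ChineseRemainder.
Variables (I : eqType) (P Q : I -> algC -> Prop).
Hypothesis idQ : forall i, is_ideal O (Q i).
Hypothesis PQ : forall i, same_set (P i) (Q i).
Hypothesis coP : forall i j, i != j -> exists2 b, P j b & P i (1 - b).

Local Notation bigQ s := (\big[ideal_mul/O]_(i <- s) Q i).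
Let bigQ_ideal s : is_ideal O (bigQ s).
Proof.
elim: s => [|i s IHs]; rewrite ?big_nil ?big_cons; first exact: unit_ideal.
exact: ideal_mul_ideal.
Qed.

Lemma big_ideal_mul_sub s x i : bigQ s x -> i \in s -> P i x.
Proof.
elim: s => // j s IHs; rewrite big_cons => Qx.
rewrite inE => /predU1P[->|/IHs]; first by apply/PQ; apply: ideal_mul_l Qx.
by apply; apply: ideal_mul_r Qx.
Qed.

(* The witness is a product of the elements given by coP i for the members of s. *)
Let bigQ_comaximal i s : i \notin s -> exists2 b, bigQ s b & P i (1 - b).
Proof.
have [iO i0 iD iM] := idQ i.
elim: s => [_|j s IHs].
  exists 1; rewrite ?big_nil; first exact: (subring1 ringO).
  by rewrite subrr; apply/PQ.
rewrite inE negb_or big_cons => /andP[/coP[b Pjb Pib] /IHs[c Qc Pic]].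
exists (b * c); first by apply: ideal_mulM => //; apply/PQ.
apply/PQ; have -> : 1 - b * c = (1 - b) + b * (1 - c) by ring.
apply: iD; first exact/PQ.
by apply: iM; last exact/PQ; have [jO _ _ _] := idQ j; apply/jO/PQ.
Qed.

Lemma big_ideal_mulI s x : uniq s -> O x -> (forall i, i \in s -> P i x) -> bigQ s x.
Proof.
move=> + Ox; elim: s => [|i s IHs]; rewrite ?big_nil ?big_cons //=.
move=> /andP[/bigQ_comaximal[b Qb Pib] /IHs Qs] Ps.
have -> : x = x * b + (1 - b) * x by ring.
apply: ideal_mulD; apply: ideal_mulM => //; try apply/PQ => //.
  by apply: Ps; exact: mem_head.
by apply: Qs => j sj; apply: Ps; rewrite inE sj orbT.
Qed.

End ChineseRemainder.

(** A nilpotent modulo p lies in all primes over p, hence in their intersection;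
    that is their product by comaximality, and their product is p O since no prime
    is repeated. *)
Theorem unramified_reduced x : K x -> nilmod p x -> x / p%:R \in Aint.
Proof.
move=> Kx rx; have Ox : O x by split=> //; exact: nilmod_Aint rx.
have [r [P [e [[prP neqP _ fact] e1]]]] := unrK.
pose Q i := ideal_exp O (P i) (e i).
have idP i : is_ideal O (P i) by case: (prP i).
have idQ i : is_ideal O (Q i).
  by rewrite /Q e1; apply: ideal_mul_ideal => //; exact: unit_ideal.
have PQ i : same_set (P i) (Q i).
  rewrite /Q e1 => y; split=> [Py|]; last by apply: ideal_mul_l => //; exact: unit_ideal.
  by rewrite -[y]mulr1; apply: ideal_mulM => //; exact: (subring1 ringO).
have Pp i : P i p%:R.
  apply: (big_ideal_mul_sub idQ PQ (s := index_enum 'I_r)); last exact: mem_index_enum.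
  by apply/fact; exists 1; [exact: (subring1 ringO) | rewrite mulr1].
have coP i j : i != j -> exists2 b, P j b & P i (1 - b).
  by move=> ij; apply: prime_ideals_comaximal => //; exact: neqP.
have /fact[y [_ Ay] ->] : (\big[ideal_mul/O]_(i < r) Q i) x.
  apply: (big_ideal_mulI idQ PQ coP) => [||i _] //; first exact: index_enum_uniq.
  exact: nilmod_prime_ideal.
by rewrite mulrC mulKf.
Qed.

Section InertiaActsTrivially.
Variable u : {rmorphism algC -> algC}.
Hypothesis stabK : forall x, K x -> K (u x).
Hypothesis radu : forall x, K x -> x \in Aint -> nilmod p (u x - x).

(* Write x = y ^+ p - p z with y and z in the ring of integers of K: raising to
   the p-th power and multiplying by p both gain a factor p over level s. *)
Let aut_eqmod s x : K x -> x \in Aint -> (u x - x) / p%:R ^+ s.+1 \in Aint.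
Proof.
elim: s x => [|s IHs] x Kx Ax.
  by apply: unramified_reduced; [apply: (subringB ringK) => //; exact: stabK | exact: radu].
pose y := x ^+ (p ^ f); pose z := (y ^+ p - x) / p%:R.
have Ky : K y by exact: (subringX ringK).
have Ay : y \in Aint by rewrite rpredX.
have Kyx : K (y ^+ p - x) by apply: (subringB ringK) => //; exact: (subringX ringK).
have Kz : K z by apply: divK => //; exact: (subring_nat ringK).
have Az : z \in Aint.
  by apply: unramified_reduced => //; rewrite -exprM -expnSr; exact: frobK.
have xE : x = y ^+ p - p%:R * z by rewrite mulrC divfK // subKr.
have -> : (u x - x) / p%:R ^+ s.+2 =
    (u y ^+ p - y ^+ p) / p%:R ^+ s.+2 - (u z - z) / p%:R ^+ s.+1.
  rewrite {1 2}xE rmorphB rmorphM rmorphXn rmorph_nat [p%:R ^+ s.+2]exprS.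
  by field; rewrite p_neq0 expf_neq0.
apply: rpredB (IHs _ Kz Az); apply: (eqmod_lift subring_Aint) => //.
  by rewrite Aint_aut.
exact: IHs.
Qed.

(** A nonzero u x - x would have a nonzero integer multiple N divisible by every
    power of p. *)
Theorem inertia_fixes_unramified x : K x -> x \in Aint -> u x = x.
Proof.
move=> Kx Ax; apply/eqP; rewrite -subr_eq0; apply/negP => /negP nz.
have Aux : u x - x \in Aint by rewrite rpredB ?Aint_aut.
have [w Aw [N N0 bw]] := dvd_nat_of_Aint subring_Aint Aux Aux nz.
have pN : p%:R ^+ N != 0 :> algC by rewrite expf_neq0.
have AN : N%:R / p%:R ^+ N \in Aint.
  by rewrite -bw mulrAC rpredM //; case: (N) N0 => // s _; exact: aut_eqmod.
have QN : N%:R / p%:R ^+ N \in Crat by rewrite rpred_div ?rpredX ?rpred_nat.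
have := norm_intr_ge1 (Cint_rat_Aint QN AN).
rewrite mulf_neq0 ?invr_eq0 ?pnatr_eq0 -?lt0n // normrM normfV normrX !normr_nat.
rewrite ler_pdivlMr ?exprn_gt0 ?ltr0n // mul1r -natrX ler_nat => /(_ isT).
by apply/negP; rewrite -ltnNge ltn_expl ?prime_gt1.
Qed.

End InertiaActsTrivially.
End Unramified.

(** * Orbit sums of linear characters *)

Section OrbitSums.
Local Open Scope ring_scope.
Variables (p a m : nat) (p_pr : prime p).
Hypotheses (copm : coprime p m) (m_gt0 : (0 < m)%N).
Variables (gT : finGroupType) (A : {group gT}).
Hypotheses (abelA : abelian A) (dvdA : (#|A| %| p ^ a.+1 * m)%N).

Let p_gt0 := prime_gt0 p_pr.
Let p_neq0 : p%:R != 0 :> algC.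
Proof. by rewrite pnatr_eq0 -lt0n. Qed.

Local Notation n := (p ^ a.+1 * m)%N.
Local Notation N := (p * m)%N.

Let n_gt0 : (0 < n)%N. Proof. by rewrite muln_gt0 expn_gt0 p_gt0. Qed.

Let lin (i : Iirr A) : 'chi_i \is a linear_char.
Proof. exact/char_abelianP. Qed.

Let irr_expn (i : Iirr A) : 'chi_i ^+ n = 1.
Proof.
by apply/eqP; rewrite -dvdn_cforder (dvdn_trans (cforder_lin_char_dvdG (lin i))).
Qed.

(** These exponents give the inertia automorphisms that are also trivial on p-th
    roots of unity: they form a p-group modulo n, whose orbit sums are geometric
    series. *)
Definition unit_exponent (k : nat) : Prop := (0 < k)%N /\ (k = 1 %[mod N])%N.

Lemma coprime_unit_exponent k : unit_exponent k -> coprime k n.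
Proof.
case=> _ k1; have: coprime k N by rewrite -coprime_modl k1 coprime_modl coprime1n.
by rewrite !coprimeMr => /andP[cp ->]; rewrite coprimeXr.
Qed.

(** The orbits of the group of unit exponents; the bound on t makes the relation
    boolean and is removed by [conj_irrP]. *)
Definition conj_irr : rel (Iirr A) :=
  fun i j => [exists t : 'I_n, 'chi_j == 'chi_i ^+ (1 + N * t)].

Lemma conj_irrP i j :
  reflect (exists2 k, unit_exponent k & 'chi_j = 'chi_i ^+ k) (conj_irr i j).
Proof.
apply: (iffP existsP) => [[t /eqP e]|[k [k0 k1] e]].
  by exists (1 + N * t)%N; rewrite // /unit_exponent -modnDmr modnMr.
have /dvdnP[s sE] : (N %| k - 1)%N by rewrite -eqn_mod_dvd // k1.
exists (Ordinal (ltn_pmod s n_gt0)); apply/eqP => /=.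
rewrite e -(expr_mod k (irr_expn i)) -(expr_mod (1 + _) (irr_expn i)).
by rewrite -modnDmr modnMmr modnDmr [(N * s)%N]mulnC -sE subnKC.
Qed.

Lemma conj_irr_equiv : equivalence_rel conj_irr.
Proof.
have R1 i : conj_irr i i by apply/conj_irrP; exists 1%N; rewrite // expr1.
have Rt i j k : conj_irr i j -> conj_irr j k -> conj_irr i k.
  move=> /conj_irrP[s [s0 s1] es] /conj_irrP[t [t0 t1] et]; apply/conj_irrP.
  exists (s * t)%N; last by rewrite et es exprM.
  by split; [rewrite muln_gt0 s0 | rewrite -modnMm s1 t1 modnMm].
have Rs i j : conj_irr i j -> conj_irr j i.
  move=> /conj_irrP[k uk e]; apply/conj_irrP; exists (k ^ (totient n).-1)%N.
    case: uk => k0 k1; split; first by rewrite expn_gt0 k0.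
    by rewrite -modnXm k1 modnXm exp1n.
  rewrite e -exprM -expnS prednK ?totient_gt0 // -(expr_mod _ (irr_expn i)).
  by rewrite (Euler_exp_totient (coprime_unit_exponent uk)) expr_mod // expr1.
move=> i j k; split=> // ij; apply/idP/idP => h; last exact: Rt h.
by apply: Rt h; exact: Rs.
Qed.

Local Notation mu i := ('chi[A]_i ^+ N).

Let mu_lin i : mu i \is a linear_char. Proof. exact: rpredX. Qed.

(** The orbit of lambda consists of the lambda mu^t with mu = lambda^N and t below
    the order of mu. *)
Lemma conj_irr_sum i x : x \in A ->
  \sum_(j | conj_irr i j) 'chi_j x =
    if ('chi_i x ^+ N == 1) then #[mu i]%CF%:R * 'chi_i x else 0.
Proof.
move=> Ax; pose d := #[mu i]%CF.
have d_gt0 : (0 < d)%N by exact: cforder_lin_char_gt0 (mu_lin i).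
pose F (t : 'I_d) := cfIirr ('chi_i * mu i ^+ t).
have FE t : 'chi_(F t) = 'chi_i * mu i ^+ t.
  by apply/cfIirrE/lin_char_irr; rewrite rpredM ?rpredX.
have F_inj : {in 'I_d &, injective F}.
  have prim : d.-primitive_root (mu i).
    rewrite /primitive_root_of_unity d_gt0; apply/forallP => k; apply/eqP.
    rewrite unity_rootE -dvdn_cforder -/d; apply/idP/eqP => [dk|->//].
    by apply/eqP; rewrite eqn_leq ltn_ord dvdn_leq.
  move=> s t _ _ /(congr1 (fun j => 'chi_j)); rewrite !FE.
  move=> /(mulrI (lin_char_unitr (lin i)))/eqP; rewrite (eq_prim_root_expr prim).
  by rewrite !modn_small // => /eqP/val_inj.
have -> : \sum_(j | conj_irr i j) 'chi_j x = \sum_(j in F @: 'I_d) 'chi_j x.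
  apply: eq_bigl => j; apply/conj_irrP/imsetP => [[k [k0 k1] e]|[t _ ->]].
    have /dvdnP[s sE] : (N %| k - 1)%N by rewrite -eqn_mod_dvd // k1.
    exists (Ordinal (ltn_pmod s d_gt0)) => //; apply: irr_inj; rewrite FE /=.
    by rewrite (expr_mod _ (exp_cforder _)) -exprM [(N * s)%N]mulnC -sE -exprS subn1 prednK.
  exists (1 + N * t)%N; last by rewrite FE -exprM exprD expr1.
  by rewrite /unit_exponent -modnDmr modnMr.
rewrite big_imset //=; under eq_bigr do rewrite FE cfunE exp_cfunE // exp_cfunE //.
rewrite -mulr_sumr; have [-> | y1] := eqVneq ('chi_i x ^+ N) 1.
  under eq_bigr do rewrite expr1n.
  by rewrite sumr_const card_ord mulrC.
have y_d : ('chi_i x ^+ N) ^+ d = 1.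
  by rewrite -exp_cfunE // -exp_cfunE // exp_cforder cfun1E Ax.
move: (subrX1 ('chi_i x ^+ N) d); rewrite y_d subrr => /esym/eqP.
by rewrite mulf_eq0 subr_eq0 (negPf y1) /= big_mkcond => /eqP ->; rewrite mulr0.
Qed.

Variables (g h : gT) (b r : nat).
Hypotheses (gA : g \in A) (hA : h \in A) (h_p : (h ^+ (p ^ b) = 1)%g).

Local Notation y := (g * h ^+ (p ^ r))%g.
Let yA : y \in A. Proof. by rewrite groupM ?groupX. Qed.

(** Let p^c be the size of the orbit.  For c > r both sums are divisible by
    p^(r+1).  For c <= r the characters of the orbit satisfy lambda(y) =
    lambda(g) e with e = lambda(h)^(p^r), and lambda(h) has order dividing
    p^(c+1); so e = 1 if c < r, and e^p = 1 if c = r. *)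
Lemma conj_irr_sum_diff i :
  nilmod p ((\sum_(j | conj_irr i j) 'chi_j g - \sum_(j | conj_irr i j) 'chi_j y)
             / (p ^ r)%:R).
Proof.
rewrite !conj_irr_sum //.
have /(dvdn_pfactor _ _ p_pr)[c _ dE] : (#[mu i]%CF %| p ^ a)%N.
  by rewrite dvdn_cforder -exprM mulnAC -expnS irr_expn.
have Achi x : 'chi_i x \in Aint by rewrite Aint_irr.
have pr0 : (p ^ r)%:R != 0 :> algC by rewrite natrX expf_neq0.
rewrite dE; have [rc|cr] := ltnP r c.
  have Apc z : z \in Aint -> nilmod p ((p ^ c)%:R * z / (p ^ r)%:R).
    move=> Az; apply: (nilmod_divp p_pr); rewrite -(subnK rc) expnD expnS !natrM.
    suff -> : (p ^ (c - r.+1))%:R * (p%:R * (p ^ r)%:R) * z / (p ^ r)%:R / p%:R =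
       (p ^ (c - r.+1))%:R * z by rewrite rpredM ?rpred_nat.
    by field; rewrite p_neq0 pr0.
  rewrite mulrBl; apply: (nilmodB p_pr); case: ifP => _; try exact: Apc.
    by rewrite mul0r; exact: nilmod0.
  by rewrite mul0r; exact: nilmod0.
pose w := 'chi_i h; pose e := w ^+ (p ^ r).
have yE : 'chi_i y = 'chi_i g * e.
  by rewrite (lin_charM (lin i)) ?groupX // (lin_charX (lin i)).
have w_pb : w ^+ (p ^ b) = 1 by rewrite -(lin_charX (lin i)) // h_p lin_char1.
have w_pc : w ^+ (p ^ c.+1) = 1.
  have w1 : (w ^+ (p ^ c.+1)) ^+ m = 1.
    rewrite -exprM expnS mulnAC exprM -dE -exp_cfunE // -exp_cfunE //.
    by rewrite exp_cforder cfun1E hA.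
  have w2 : (w ^+ (p ^ c.+1)) ^+ (p ^ b) = 1 by rewrite exprAC w_pb expr1n.
  have /eqP g1 : coprime m (p ^ b) by rewrite coprime_sym coprimeXl.
  case: (egcdnP (p ^ b) m_gt0) => s t; rewrite g1 => st _.
  rewrite -[LHS]expr1 -[LHS]mul1r -{1}(expr1n _ t) -w2 -exprM mulnC -exprD.
  by rewrite -st mulnC exprM w1 expr1n.
have eN : e ^+ N = 1.
  rewrite -exprM mulnA -expnSr; have /subnK <- : (c.+1 <= r.+1)%N by [].
  by rewrite expnD -mulnA mulnCA exprM w_pc expr1n.
rewrite yE exprMn eN mulr1; case: ifP => _; last first.
  by rewrite subrr mul0r; exact: nilmod0.
move: cr; rewrite leq_eqVlt => /predU1P[cr|cr].
  rewrite -cr -mulrBr mulrAC divff ?mul1r; last by rewrite cr.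
  have -> : 'chi_i g - 'chi_i g * e = - 'chi_i g * (e - 1) by ring.
  apply: nilmodMl; first by rewrite rpredN.
  by apply: (nilmod_unity_root p_pr (a := 1)); rewrite -exprM -cr -expnD addn1.
have -> : e = 1.
  by rewrite /e -(subnK cr) expnD mulnC exprM w_pc expr1n.
by rewrite mulr1 subrr mul0r; exact: nilmod0.
Qed.

Lemma char_diff_nilmod (psi : 'CF(A)) : psi \is a character ->
  (forall i j, conj_irr i j -> '[psi, 'chi_j] = '[psi, 'chi_i]) ->
  nilmod p ((psi g - psi y) / (p ^ r)%:R).
Proof.
move=> Npsi psi_conj; have eqv : {in setT & &, equivalence_rel conj_irr}.
  by move=> i j k _ _ _; exact: conj_irr_equiv.
have partR := equivalence_partitionP eqv; set P := equivalence_partition _ _ in partR.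
have psiE x : psi x = \sum_(C in P) \sum_(i in C) '[psi, 'chi_i] * 'chi_i x.
  rewrite {1}[psi]cfun_sum_cfdot sum_cfunE -(set_partition_big _ partR) /=.
  by apply: eq_big => [i|i _]; rewrite ?inE // cfunE.
rewrite !psiE -sumrB mulr_suml; apply: (nilmod_sum p_pr) => C /imsetP[i _ ->].
have sumE x : \sum_(j in [set j in setT | conj_irr i j]) '[psi, 'chi_j] * 'chi_j x =
    '[psi, 'chi_i] * \sum_(j | conj_irr i j) 'chi_j x.
  by rewrite mulr_sumr; apply: eq_big => j; rewrite !inE // => /psi_conj->.
rewrite !sumE -mulrBr -mulrA; apply: nilmodMl; last exact: conj_irr_sum_diff.
by apply/Aint_Cnat/Cnat_cfdot_char => //; exact: irr_char.
Qed.

End OrbitSums.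

(** * The field of values of a character *)

Section CharacterField.
Local Open Scope ring_scope.
Variables (gT : finGroupType) (G : {group gT}) (chi : 'CF(G)).
Hypothesis Nchi : chi \is a character.
Local Notation K := (character_field chi).

Lemma subfield_character_field : subfield K.
Proof.
split=> [S [] //|x y Kx Ky S fS chiS|x y Kx Ky S fS chiS].
  by case: (fS) => _ SB _; apply: SB; [exact: Kx | exact: Ky].
by case: (fS) => _ _ SV; apply: SV; [exact: Kx | exact: Ky].
Qed.

Lemma character_field_char x : x \in G -> K (chi x).
Proof. by move=> Gx S _; apply. Qed.

Lemma character_field_cycrat x : K x -> cycrat #|G| x.
Proof.
apply; first exact/subfield_cycrat/cardG_gt0.
move=> g _; exists 1%N; rewrite // mul1r; exact: char_cycint.
Qed.

Lemma aut_char (u : {rmorphism algC -> algC}) k x : x \in G ->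
  (forall z, z ^+ #|G| = 1 -> u z = z ^+ k) -> u (chi x) = chi (x ^+ k)%g.
Proof.
move=> Gx uE; have sxG : (<[x]> \subset G)%g by rewrite cycle_subG.
have [r Er] := char_sum_irr (cfRes_char <[x]>%G Nchi).
rewrite -!(cfResE chi sxG) ?mem_cycle ?cycle_id // Er !sum_cfunE rmorph_sum.
apply: eq_bigr => i _.
have lin : 'chi_i \is a linear_char by apply/char_abelianP; exact: cycle_abelian.
rewrite (lin_charX lin) ?cycle_id // uE //.
have /dvdnP[t ->] : (#[x]%g %| #|G|)%N by exact: order_dvdG.
by rewrite mulnC exprM (lin_char_unity_root lin (cycle_id x)) expr1n.
Qed.

Lemma character_field_aut (u : {rmorphism algC -> algC}) k x :
  (forall z, z ^+ #|G| = 1 -> u z = z ^+ k) -> K x -> K (u x).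
Proof.
move=> uE Kx; apply: (Kx (fun z => K (u z))); last first.
  by move=> g Gg; rewrite (aut_char Gg uE); apply: character_field_char; exact: groupX.
have [K1 KB KV] := subfield_character_field.
split=> [|y z Ky Kz|y z Ky Kz]; first by rewrite rmorph1.
  by rewrite rmorphB; exact: KB.
by rewrite fmorph_div; exact: KV.
Qed.

Section AtPrime.
Variables (p a m : nat) (p_pr : prime p).
Hypotheses (copm : coprime p m) (m_gt0 : (0 < m)%N) (cardG : #|G| = (p ^ a.+1 * m)%N).

Let p_gt0 := prime_gt0 p_pr.

Lemma character_field_cycint x : K x -> x \in Aint ->
  exists2 D, coprime D p & cycint (p ^ a.+1 * m) (D%:R * x).
Proof.
move=> Kx Ax; have [D D0 CDx] := character_field_cycrat Kx; rewrite cardG in CDx.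
have [w w_prim] : {w : algC | (p ^ a.+1).-primitive_root w}.
  by apply: C_prim_root_exists; rewrite expn_gt0 p_gt0.
exact: (cycint_primeto p_pr copm m_gt0 w_prim D0 Ax CDx).
Qed.

(** On Z[zeta_n] this is [cycint_frobenius_nilmod]; the multiplier D satisfies the
    same congruence and can be cancelled. *)
Lemma character_field_frobenius f x : (p ^ f = 1 %[mod m])%N ->
  K x -> x \in Aint -> nilmod p (x ^+ (p ^ f) - x).
Proof.
move=> f1 Kx Ax; have [D coDp CDx] := character_field_cycint Kx Ax.
apply: (nilmod_of_coprime p_pr coDp); first by rewrite rpredB ?rpredX.
have CD : cycint (p ^ a.+1 * m) D%:R by exact: (subring_nat (subring_cycint _)).
have -> : D%:R * (x ^+ (p ^ f) - x) = ((D%:R * x) ^+ (p ^ f) - D%:R * x)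
    - (D%:R ^+ (p ^ f) - D%:R) * x ^+ (p ^ f) by rewrite exprMn; ring.
apply: (nilmodB p_pr); first exact: (cycint_frobenius_nilmod p_pr m_gt0 f1 CDx).
by apply: nilmodMr; [rewrite rpredX | exact: cycint_frobenius_nilmod CD].
Qed.

Hypothesis unrK : unramified_at p K.

Lemma character_field_reduced x : K x -> nilmod p x -> x / p%:R \in Aint.
Proof.
apply: (unramified_reduced p_pr subfield_character_field unrK (f := (totient m).-1)) => z.
apply: character_field_frobenius.
by rewrite prednK ?totient_gt0 // Euler_exp_totient.
Qed.

Lemma unramified_char_fixed (u : {rmorphism algC -> algC}) k x :
  (0 < k)%N -> (k = 1 %[mod m])%N -> (forall z, z ^+ #|G| = 1 -> u z = z ^+ k) ->
  x \in G -> u (chi x) = chi x.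
Proof.
move=> k0 k1 uE Gx.
apply: (inertia_fixes_unramified p_pr subfield_character_field unrK (f := (totient m).-1)).
- move=> z; apply: character_field_frobenius.
  by rewrite prednK ?totient_gt0 // Euler_exp_totient.
- by move=> z; exact: (character_field_aut uE).
- move=> z Kz Az; have [D coDp CDz] := character_field_cycint Kz Az.
  apply: (nilmod_of_coprime p_pr coDp); first by rewrite rpredB ?Aint_aut.
  rewrite mulrBr -{1}(rmorph_nat u D) -rmorphM.
  by apply: (cycint_aut_nilmod p_pr m_gt0 k0 k1 _ CDz); rewrite -cardG.
- exact: character_field_char.
exact: Aint_char.
Qed.

(** The multiplicities of conjugate characters in the restriction of chi to <g, h>
    agree since chi is fixed by the automorphism that conjugates them.  The
    difference divided by p^r then lies in K and is nilpotent modulo p. *)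
Lemma unramified_char_eqmod g h b r : g \in G -> h \in G -> commute h g ->
  (h ^+ (p ^ b) = 1)%g ->
  (chi g - chi (g * h ^+ (p ^ r))%g) / (p ^ r.+1)%:R \in Aint.
Proof.
move=> Gg Gh chg h_p; pose A := (<[g]> <*> <[h]>)%G.
have abelA : abelian A.
  by rewrite abelianY !cycle_abelian cent_cycle cycle_subG; apply/cent1P.
have sAG : A \subset G by rewrite join_subG !cycle_subG Gg.
have Ag : g \in A by apply: (subsetP (joing_subl _ _)); exact: cycle_id.
have Ah : h \in A by apply: (subsetP (joing_subr _ _)); exact: cycle_id.
have dvdA : (#|A| %| p ^ a.+1 * m)%N by rewrite -cardG cardSg.
pose psi := 'Res[A] chi; have Npsi : psi \is a character by exact: cfRes_char.
have psi_conj i j : conj_irr p a m i j -> '[psi, 'chi_j] = '[psi, 'chi_i].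
  case/(conj_irrP p_pr m_gt0 abelA dvdA) => k uk e.
  have [k0 kN] := uk; have km : (k = 1 %[mod m])%N.
    by rewrite -(modn_dvdm k (dvdn_mull p (dvdnn m))) kN modn_dvdm // dvdn_mull.
  have [u uE] := Qn_aut_exists (coprime_unit_exponent a uk).
  rewrite -cardG in uE.
  have psiu : cfAut u psi = psi.
    apply/cfun_inP => x Ax; have Gx := subsetP sAG x Ax.
    by rewrite cfunE cfResE // (unramified_char_fixed k0 km uE).
  have chiu : cfAut u 'chi_i = 'chi_j.
    apply/cfun_inP => x Ax; rewrite e cfunE exp_cfunE // uE //.
    have lin : 'chi_i \is a linear_char by exact/char_abelianP.
    have /dvdnP[t ->] : (#[x]%g %| #|G|)%N by apply/order_dvdG/(subsetP sAG).
    by rewrite mulnC exprM (lin_char_unity_root lin Ax) expr1n.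
  rewrite -chiu -{1}psiu cfdot_aut_irr aut_natr //.
  by apply: Cnat_cfdot_char => //; exact: irr_char.
have := char_diff_nilmod p_pr copm m_gt0 abelA dvdA r Ag Ah h_p Npsi psi_conj.
rewrite !cfResE ?groupM ?groupX // => nil.
rewrite expnSr natrM invfM mulrA; apply: character_field_reduced => //.
have [K1 KB KV] := subfield_character_field.
have Kchi x : x \in G -> K (chi x) by exact: character_field_char.
apply: (KV); first by apply: KB; apply: Kchi; rewrite ?groupM ?groupX.
exact: (subring_nat (subfield_subring subfield_character_field)).
Qed.

End AtPrime.
End CharacterField.

Unset Implicit Arguments.

Theorem theorem3p4 (gT : finGroupType) (G : {group gT}) (p m : nat)
    (p_pr : prime p) (p_dvd_G : p %| #|G|) (m_ge1 : 1 <= m)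
    (g h : gT) (gG : g \in G) (hG : h \in G)
    (cgh : commute h g) (p_h : exists k : nat, #[h]%g = p ^ k)
    (chi : 'CF(G)) (chi_char : chi \is a character)
    (chi_unr : unramified_at p (character_field chi)) :
  (chi g == chi (g * h ^+ (p ^ (m - 1)))%g %[mod (p ^ m)%N])%A.
Proof.
have [m' cop cardG] := pfactor_coprime p_pr (cardG_gt0 G).
have m'0 : 0 < m' by have := cardG_gt0 G; rewrite cardG muln_gt0 => /andP[].
have: 0 < logn p #|G| by rewrite logn_gt0 mem_primes p_pr cardG_gt0.
case: (logn p #|G|) cardG => // a; rewrite mulnC => cardG _.
have [b hb] := p_h; have h1 : (h ^+ (p ^ b) = 1)%g by rewrite -hb expg_order.
case: m m_ge1 => // r _; rewrite subn1 /=.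
rewrite /eqAmod unfold_in pnatr_eq0 expn_eq0 (gtn_eqF (prime_gt0 p_pr)) /=.
exact: (unramified_char_eqmod chi_char p_pr cop m'0 cardG chi_unr r gG hG cgh h1).
Qed.
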